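(* Fix an integer $k\geq 2$ and let $(\mathcal{R}_n)_{n\geq 0}$ be the $k$-step Narayana numbers, defined by $\mathcal{R}_0=0$, $\mathcal{R}_i=1$ for $1\leq i\leq k-1$, and $\mathcal{R}_n=\mathcal{R}_{n-1}+\mathcal{R}_{n-k}$ for $n\geq k$. Then for every integer $n\geq 0$, \[ \left(k^k+(k-1)^{k-1}\right)\sum_{i=0}^{n}\mathcal{R}_i\mathcal{R}_{n-i} = k^{k-1}(n+k-2)\,\mathcal{R}_{n+k-1} - \sum_{j=0}^{k-2} k^{j}(k-1)^{k-2-j}\,(n+k+j-1)\,\mathcal{R}_{n+j}. \]
   Context: For $k=2$ the sequence $\mathcal{R}_n$ is the Fibonacci sequence. *)

(* Defs.v *)
From mathcomp Require Import all_boot all_order all_algebra.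

Set Implicit Arguments.
Unset Strict Implicit.
Unset Printing Implicit Defensive.

(* The list [:: R_n; R_(n-1); ...; R_0] of the k-step Narayana numbers, latest
   first, so that R_(n+1-k) sits at position k-1. *)
Fixpoint narayana_hist (k n : nat) : seq nat :=
  if n is m.+1 then
    let s := narayana_hist k m in
    (if m.+1 < k then 1 else nth 0 s 0 + nth 0 s k.-1) :: s
  else [:: 0].

Definition narayana (k n : nat) : nat := head 0 (narayana_hist k n).

Lemma nth_narayana_hist k n i :
  i <= n -> nth 0 (narayana_hist k n) i = narayana k (n - i).
Proof.
elim: n i => [|n IHn] [|i] //= le_in; exact: IHn.
Qed.

Lemma narayana0 k : narayana k 0 = 0.
Proof. by []. Qed.

Lemma narayana_init k i : 1 <= i -> i <= k - 1 -> narayana k i = 1.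
Proof.
case: i k => [|i] [|k] //= _; rewrite subSS subn0 => lt_ik.
by rewrite /narayana /= ltnS lt_ik.
Qed.

Lemma narayana_rec k n : 2 <= k -> k <= n ->
  narayana k n = narayana k (n - 1) + narayana k (n - k).
Proof.
case: k n => [|k] [|n] // k_ge2 le_kn.
by rewrite {1}/narayana /= ltnNge le_kn /= !nth_narayana_hist //.
Qed.

(* Main.v *)
Require Import Defs.
From mathcomp Require Import all_boot all_order all_algebra.
From mathcomp Require Import zify ring.

Set Implicit Arguments.
Unset Strict Implicit.
Unset Printing Implicit Defensive.

Import Order.TTheory GRing.Theory Num.Theory.
Local Open Scope ring_scope.

(** Extended by zeros to negative indices, the Narayana sequence [r] is the
    impulse response of [L f z = f z - f (z - 1) - f (z - k)]: [L r] is the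
    indicator of [1]. Hence [L] sends the convolution of [r] with itself to [r
    (z - 1)]. It sends the right-hand side to [k ^ k + (k - 1) ^ (k - 1)]
    times the same sequence: by the product rule for [L], and because [(z - 1)
    * L r z = 0], the sum over [j] becomes a telescoping one. Both sides
    vanish at all small enough indices, so they agree. The argument works with
    arbitrary coefficients [a] and [b] in place of [1]. *)

Section TrinomialOperator.

Variables (R : comNzRingType) (k : nat) (a b : R).
Implicit Types (f g : int -> R) (z : int).

Definition trinomial_op f z : R := f z - a * f (z - 1) - b * f (z - k%:Z).

Lemma trinomial_opB f g z :
  trinomial_op (fun y => f y - g y) z = trinomial_op f z - trinomial_op g z.
Proof. by rewrite /trinomial_op; ring. Qed.

Lemma trinomial_opZ c f z :
  trinomial_op (fun y => c * f y) z = c * trinomial_op f z.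
Proof. by rewrite /trinomial_op; ring. Qed.

Lemma trinomial_op_sum I (r : seq I) (F : I -> int -> R) z :
  trinomial_op (fun y => \sum_(i <- r) F i y) z
  = \sum_(i <- r) trinomial_op (F i) z.
Proof. by rewrite /trinomial_op !mulr_sumr -!sumrB. Qed.

Lemma trinomial_op_shift f s z :
  trinomial_op (fun y => f (y + s)) z = trinomial_op f (z + s).
Proof. by rewrite /trinomial_op !(addrAC z _ s). Qed.

Lemma trinomial_op_mul_index f s z :
  trinomial_op (fun y => (y + s)%:~R * f y) z
  = (z + s)%:~R * trinomial_op f z + a * f (z - 1) + k%:R * b * f (z - k%:Z).
Proof. by rewrite /trinomial_op; ring. Qed.

Lemma trinomial_op_inj f g z0 z1 : (0 < k)%N ->
    (forall z, z <= z0 -> f z = g z) ->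
    (forall z, z <= z1 -> trinomial_op f z = trinomial_op g z) ->
  forall z, z <= z1 -> f z = g z.
Proof.
move=> k_gt0 eq_init eq_op z.
have [m le_zm] : exists m : nat, z <= z0 + m%:Z by exists `|z - z0|%N; lia.
elim/ltn_ind: m z le_zm => m IHm z le_zm le_z1.
have [/eq_init //|lt_z0z] := leP z z0.
have eq_before y : y < z -> f y = g y by move=> lt_yz; apply: (IHm m.-1); lia.
have := eq_op z le_z1; rewrite /trinomial_op.
rewrite (eq_before (z - 1)) ?(eq_before (z - _)); [|lia..].
by move/addIr/addIr.
Qed.

End TrinomialOperator.

Section ImpulseResponse.

Variables (R : comNzRingType) (p : nat) (a b : R) (u : int -> R).
Local Notation k := p.+1.
Local Notation L := (trinomial_op k a b).

Implicit Types (w : int -> R) (z : int).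

Hypothesis u_eq0 : forall z : int, z <= 0 -> u z = 0.
Hypothesis u_impulse : forall z : int, L u z = (z == 1)%:R.

(* Cutting the sum off at [N] instead of at [z] lets [L] act on it term by term;
   the two agree for [z <= N] when [w] and [u] vanish at negative indices. *)
Definition truncated_conv (N : nat) (w : int -> R) (z : int) : R :=
  \sum_(0 <= i < N) w i%:Z * u (z - i%:Z).

Lemma truncated_conv_eq0 N w z : z <= 0 -> truncated_conv N w z = 0.
Proof. by move=> le_z0; apply: big1 => i _; rewrite u_eq0 ?mulr0 //; lia. Qed.

Lemma trinomial_op_truncated_conv N w z :
    (forall y, y < 0 -> w y = 0) -> z <= N%:Z ->
  L (truncated_conv N w) z = w (z - 1).
Proof.
move=> w_eq0 le_zN; rewrite trinomial_op_sum.
under eq_bigr do rewrite trinomial_opZ trinomial_op_shift u_impulse.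
have [lt_z1|le_1z] := ltP z 1.
  rewrite w_eq0 ?big1 // => [i _|]; last lia.
  by rewrite (_ : (_ == 1) = false) ?mulr0 //; lia.
have [m def_z] : exists m : nat, z = m%:Z + 1 by exists `|z - 1|%N; lia.
rewrite (bigD1_seq m) ?mem_index_iota ?iota_uniq //=; last lia.
rewrite big1 ?addr0 => [|i ne_im].
  by rewrite def_z addrK (_ : (_ == 1) = true) ?mulr1 //; lia.
by rewrite (_ : (_ == 1) = false) ?mulr0 //; lia.
Qed.

Lemma predz_mul_impulse_eq0 z : (z - 1)%:~R * L u z = 0.
Proof.
by rewrite u_impulse; case: eqP => [->|_]; rewrite ?subrr ?mul0r ?mulr0.
Qed.

Lemma trinomial_op_predz_mul z :
  L (fun y => (y - 1)%:~R * u y) z = a * u (z - 1) + k%:R * b * u (z - k%:Z).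
Proof. by rewrite trinomial_op_mul_index predz_mul_impulse_eq0 add0r. Qed.

Lemma trinomial_op_addz_mul z :
  L (fun y => (y + p%:Z)%:~R * u y) z = k%:R * u z - p%:R * a * u (z - 1).
Proof.
have := predz_mul_impulse_eq0 z.
rewrite trinomial_op_mul_index /trinomial_op => eq0.
by apply/eqP; rewrite -subr_eq0 -eq0; apply/eqP; ring.
Qed.

Definition index_weighted_sum (z : int) : R :=
  \sum_(0 <= j < p) k%:R ^+ j * (p%:R * a) ^+ (p.-1 - j)
    * ((z + j%:Z + p%:Z)%:~R * u (z + j%:Z)).

Lemma trinomial_op_index_weighted_sum z :
  L index_weighted_sum z =
  k%:R ^+ p * u (z + p%:Z - 1) - (p%:R * a) ^+ p * u (z - 1).
Proof.
rewrite trinomial_op_sum.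
pose term j : R := k%:R ^+ j * (p%:R * a) ^+ (p - j) * u (z + j%:Z - 1).
transitivity (term p - term 0).
  rewrite -telescope_sumr //; apply: eq_big_nat => j /andP[_ lt_jp].
  rewrite trinomial_opZ.
  rewrite (trinomial_op_shift _ _ _ (fun y => (y + p%:Z)%:~R * u y)).
  rewrite trinomial_op_addz_mul /term.
  have -> : (p - j = (p.-1 - j).+1)%N by lia.
  have -> : (p - j.+1 = p.-1 - j)%N by lia.
  have -> : z + j.+1%:Z - 1 = z + j%:Z by lia.
  by rewrite !exprS; ring.
by rewrite /term subnn subn0 !expr0 mulr1 mul1r addr0.
Qed.

Definition conv_closed_form (z : int) : R :=
  k%:R ^+ p * ((z + p%:Z - 1)%:~R * u (z + p%:Z)) - a * index_weighted_sum z.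

Lemma conv_closed_form_eq0 z : z <= - p%:Z -> conv_closed_form z = 0.
Proof.
move=> le_z; rewrite /conv_closed_form u_eq0; last lia.
rewrite !mulr0 sub0r /index_weighted_sum.
rewrite big_nat big1 ?mulr0 ?oppr0 // => j lt_jp.
by rewrite u_eq0 ?mulr0 //; lia.
Qed.

Lemma trinomial_op_conv_closed_form z :
  L conv_closed_form z = (k%:R ^+ k * b + p%:R ^+ p * a ^+ k) * u (z - 1).
Proof.
rewrite trinomial_opB !trinomial_opZ trinomial_op_index_weighted_sum.
rewrite (trinomial_op_shift _ _ _ (fun y => (y - 1)%:~R * u y)).
rewrite trinomial_op_predz_mul.
have -> : z + p%:Z - k%:Z = z - 1 by lia.
by rewrite exprMn !exprS; ring.
Qed.

Lemma impulse_response_conv (n : nat) :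
  (k%:R ^+ k * b + p%:R ^+ p * a ^+ k) *
    (\sum_(0 <= i < n.+1) u i%:Z * u (n%:Z - i%:Z))
  = conv_closed_form n%:Z.
Proof.
rewrite -/(truncated_conv n.+1 u n%:Z).
have le_n : n%:Z <= n.+1%:Z by lia.
move: n%:Z le_n; apply: (@trinomial_op_inj _ k a b _ _ (- p%:Z)) => // z le_z.
  by rewrite truncated_conv_eq0 ?mulr0 ?conv_closed_form_eq0 //; lia.
rewrite trinomial_op_conv_closed_form trinomial_opZ.
rewrite trinomial_op_truncated_conv //.
by move=> y /ltW; apply: u_eq0.
Qed.

End ImpulseResponse.

Definition narayanaz (k : nat) (z : int) : int :=
  if z is Posz n then (narayana k n)%:Z else 0.

Lemma narayanaz_eq0 k z : z <= 0 -> narayanaz k z = 0.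
Proof. by case: z => [[|n]|n]. Qed.

Lemma narayanaz_impulse k : (2 <= k)%N ->
  forall z, trinomial_op k 1 1 (narayanaz k) z = (z == 1)%:R.
Proof.
move=> k_ge2 z; rewrite /trinomial_op !mul1r.
have [lt_z1|] := ltP z 1.
  rewrite !narayanaz_eq0 ?subr0; [|lia..].
  by rewrite (_ : (z == 1) = false) //; lia.
case: z => [[|n]|] // _.
have -> : n.+1%:Z - 1 = n%:Z by lia.
have [le_kn|lt_nk] := leqP k n.+1.
  rewrite subzn //= narayana_rec // subn1 PoszD -addrA -opprD subrr.
  by have -> : (n.+1%:Z == 1) = false by lia.
rewrite (@narayanaz_eq0 k (_ - _)) ?subr0; last lia.
case: n lt_nk => [|n] lt_nk /=; first by rewrite narayana_init //; lia.
by rewrite !narayana_init ?subrr //; lia.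
Qed.

Theorem theorem4p1 (k : nat) (hk : (2 <= k)%N) (n : nat) :
  (k%:Z ^+ k + (k%:Z - 1) ^+ (k - 1)) *
    (\sum_(0 <= i < n.+1) (narayana k i)%:Z * (narayana k (n - i))%:Z)
  = k%:Z ^+ (k - 1) * (n%:Z + k%:Z - 2) * (narayana k (n + k - 1))%:Z
    - \sum_(0 <= j < k - 1)
        k%:Z ^+ j * (k%:Z - 1) ^+ (k - 2 - j) * (n%:Z + k%:Z + j%:Z - 1)
          * (narayana k (n + j))%:Z.
Proof.
have R_impulse := narayanaz_impulse hk.
case: k hk R_impulse => [|p] //= _ R_impulse.
have := impulse_response_conv (@narayanaz_eq0 p.+1) R_impulse n.
rewrite !natz !expr1n !mulr1 /conv_closed_form /index_weighted_sum mul1r !natz.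
have -> : p.+1%:Z - 1 = p%:Z by lia.
have -> : (p.+1 - 1 = p)%N by lia.
have -> : (n + p.+1 - 1 = n + p)%N by lia.
have -> : n%:Z + p.+1%:Z - 2 = n%:Z + p%:Z - 1 by lia.
rewrite intz -mulrA => conv_eq.
have -> : \sum_(0 <= i < n.+1) (narayana p.+1 i)%:Z * (narayana p.+1 (n - i))%:Z
    = \sum_(0 <= i < n.+1) narayanaz p.+1 i%:Z * narayanaz p.+1 (n%:Z - i%:Z).
  by apply: eq_big_nat => i /andP[_ le_in]; rewrite subzn.
rewrite conv_eq; congr (_ - _); apply: eq_big_nat => j _.
by rewrite mulr1 intz mulrA; congr (_ ^+ _ * _ ^+ _ * _ * _); lia.
Qed.
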